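(* Consider GDA with step sizes $\eta_x=\frac{c_1}{\kappa^2\ell}$ and $\eta_y=\frac{c_2}{\ell}$, where $c_1,c_2>0$ are fixed numerical constants and $\kappa=\ell/\mu$. There is a constant $c>0$ depending only on $c_1,c_2$ and $\ell$ such that for all $\ell\ge\mu>0$, all $\Delta>0$ and all sufficiently small $\epsilon>0$ there exist a function $f(\cdot,\cdot)$ that is $\ell$-gradient Lipschitz (i.e. $\ell$-smooth) and $\mu$-strongly concave in $y$, and an initialization $(x_0,y_0)$ with $\Delta_\Phi=\Delta$, such that the following holds: if $\bar x$ is the solution returned by GDA after $T$ iterations and $\|\nabla\Phi(\bar x)\|\le\epsilon$, then $$T\ \ge\ c\,\frac{\kappa^2\Delta_\Phi}{\epsilon^2}.$$ (That is, $T=\Omega(\kappa^2\Delta_\Phi/\epsilon^2)$ iterations are required to guarantee $\|\nabla\Phi(\bar x)\|\le\epsilon$.)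
   Context: $f$ is $\ell$-smooth if it is differentiable and $\|\nabla f(x_1,y_1)-\nabla f(x_2,y_2)\|^2\le \ell^2\|x_1-x_2\|^2+\ell^2\|y_1-y_2\|^2$. The primal function is $\Phi(x)=\max_yf(x,y)$, and $\Delta_\Phi=\max(\Phi(x_1),\Phi(x_0))-\min_x\Phi(x)$. The dual variable is unconstrained. GDA: $x_t=x_{t-1}-\eta_x\nabla_xf(x_{t-1},y_{t-1})$, $y_t=y_{t-1}+\eta_y\nabla_yf(x_{t-1},y_{t-1})$ for $t=1,\dots,T$; the returned $\bar x$ is chosen at random from $x_1,\dots,x_T$. *)

(* Defs.v *)
From HB Require Import structures.
From mathcomp Require Import all_boot all_order all_algebra.
From mathcomp Require Import all_classical all_reals all_analysis.
Import Order.TTheory GRing.Theory Num.Theory.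
Import numFieldNormedType.Exports.

Set Implicit Arguments.
Unset Strict Implicit.
Unset Printing Implicit Defensive.

Local Open Scope ring_scope.

(* The library norm on ['rV[R]_n] is the sup norm, so the Euclidean norm is
   defined here; both induce the same notion of differentiability. *)
Definition enorm (R : realType) (n : nat) (v : 'rV[R]_n) : R :=
  Num.sqrt (\sum_(i < n) v ord0 i ^+ 2).

Definition grad (R : realType) (n : nat) (g : 'rV[R]_n -> R) (x : 'rV[R]_n) :
    'rV[R]_n :=
  \row_(i < n) 'D_(delta_mx ord0 i) g x.

Definition gradx (R : realType) (m n : nat) (f : 'rV[R]_m -> 'rV[R]_n -> R)
    (x : 'rV[R]_m) (y : 'rV[R]_n) : 'rV[R]_m :=
  grad (fun x' => f x' y) x.

Definition grady (R : realType) (m n : nat) (f : 'rV[R]_m -> 'rV[R]_n -> R)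
    (x : 'rV[R]_m) (y : 'rV[R]_n) : 'rV[R]_n :=
  grad (f x) y.

(* The full gradient is the concatenation of [gradx] and [grady], hence its
   squared Euclidean norm is the sum of the two squared norms. *)
Definition smooth (R : realType) (m n : nat) (l : R)
    (f : 'rV[R]_m -> 'rV[R]_n -> R) : Prop :=
  (forall p : 'rV[R]_m * 'rV[R]_n, differentiable (fun q => f q.1 q.2) p) /\
  (forall x1 x2 y1 y2,
     enorm (gradx f x1 y1 - gradx f x2 y2) ^+ 2
     + enorm (grady f x1 y1 - grady f x2 y2) ^+ 2
     <= l ^+ 2 * enorm (x1 - x2) ^+ 2 + l ^+ 2 * enorm (y1 - y2) ^+ 2).

Definition strongly_concave (R : realType) (n : nat) (mu : R)
    (g : 'rV[R]_n -> R) : Prop :=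
  forall (y1 y2 : 'rV[R]_n) (s : R), 0 <= s <= 1 ->
    s * g y1 + (1 - s) * g y2 + mu / 2 * (s * (1 - s)) * enorm (y1 - y2) ^+ 2
    <= g (s *: y1 + (1 - s) *: y2).

Definition is_primal (R : realType) (m n : nat)
    (f : 'rV[R]_m -> 'rV[R]_n -> R) (Phi : 'rV[R]_m -> R) : Prop :=
  forall x, exists2 y, Phi x = f x y & forall y', f x y' <= f x y.

Definition gda_step (R : realType) (m n : nat) (etax etay : R)
    (f : 'rV[R]_m -> 'rV[R]_n -> R) (p : 'rV[R]_m * 'rV[R]_n) :
    'rV[R]_m * 'rV[R]_n :=
  (p.1 - etax *: gradx f p.1 p.2, p.2 + etay *: grady f p.1 p.2).

Definition gda (R : realType) (m n : nat) (etax etay : R)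
    (f : 'rV[R]_m -> 'rV[R]_n -> R) (x0 : 'rV[R]_m) (y0 : 'rV[R]_n) (t : nat) :
    'rV[R]_m * 'rV[R]_n :=
  iter t (gda_step etax etay f) (x0, y0).

(* Stated as a relation so that the minimum of [Phi] is required to be
   attained; [inf] would take a default value when [Phi] is unbounded below. *)
Definition is_primal_gap (R : realType) (m : nat) (Phi : 'rV[R]_m -> R)
    (x0 x1 : 'rV[R]_m) (Delta : R) : Prop :=
  exists2 xmin, (forall x, Phi xmin <= Phi x) &
    Delta = Num.max (Phi x1) (Phi x0) - Phi xmin.

(* Main.v *)
(* The decoupled function f(x, y) = huber(x_0) - mu/2 |y|^2 is already hard:
   its primal function is huber(x_0), and on x GDA is gradient descent with the
   small step etax = c1 / (kappa^2 l).  Take slope 2 eps outside the quadratic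
   zone and start at height Delta, i.e. at distance about Delta / (2 eps).  The
   gradient stays above eps until that distance is covered, by steps of length
   at most 2 eps etax, which takes about Delta / (4 eps^2 etax) iterations. *)
Require Import Defs.
From HB Require Import structures.
From mathcomp Require Import all_boot all_order all_algebra.
From mathcomp Require Import all_classical all_reals all_analysis.
From mathcomp Require Import ring lra.
Import Order.TTheory GRing.Theory Num.Theory.
Import numFieldNormedType.Exports.
Local Open Scope ring_scope.

Set Implicit Arguments.
Unset Strict Implicit.
Unset Printing Implicit Defensive.

(** * Derivatives from quadratic remainders, and the Huber function *)

(** Dividing a remainder of order [t ^+ 2] by [t] leaves an error that vanishes with [t]. With this
    criterion the junction of the two Huber pieces needs no separate treatment. *)
Lemma is_derive_quadratic_bound (R : realType) (V : normedModType R)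
    (f : V -> R) (a v : V) (d K : R) :
  (forall t : R, `|f (t *: v + a) - f a - t * d| <= K * t ^+ 2) ->
  is_derive a v f d.
Proof.
move=> fK.
have q_to_d : ((fun t : R => t^-1 *: ((f \o shift a) (t *: v) - f a)) @ 0^' --> d)%classic.
  apply/cvgrPdist_le => e e0.
  near=> t.
  have t0 : t != 0 by near: t; exact: nbhs_dnbhs_neq.
  have tn0 : 0 < `|t| by rewrite normr_gt0.
  have -> : d - t^-1 *: ((f \o shift a) (t *: v) - f a) =
            - (t^-1 * (f (t *: v + a) - f a - t * d)).
    by rewrite /= /GRing.scale /=; field.
  rewrite normrN normrM normfV ler_pdivrMl//.
  apply: (le_trans (fK t)); rewrite -[t ^+ 2]real_normK ?num_real//.
  (* The sign of [K] is unknown and it may be 0; adding 1 keeps the divisor positive. *)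
  have te : `|t| <= e / (`|K| + 1).
    near: t; apply: (@dnbhs0_le R R^o); exact: divr_gt0.
  rewrite expr2 mulrCA ler_wpM2l ?normr_ge0//.
  apply: (@le_trans _ _ ((`|K| + 1) * `|t|)).
    by rewrite ler_wpM2r ?normr_ge0// (le_trans (ler_norm K))// lerDl.
  by rewrite mulrC -ler_pdivlMr// ltr_wpDl.
split; first by apply/cvg_ex; exists d.
exact: cvg_lim q_to_d.
Unshelve. all: by end_near. Qed.

(* For [x >= 0] this is the Huber function; it is left quadratic on the
   negative side, which keeps [0] as its minimiser. *)
Definition huber (R : realType) (l del x : R) : R :=
  l * (Num.min x del * x - Num.min x del ^+ 2 / 2).

(** The slope [l * Num.min x del] is [l]-Lipschitz in [x], which bounds the Taylor remainder; the
    four cases compare [x] and [x + t] with [del]. *)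
Lemma huber_quadratic_bound (R : realType) (l del x t : R) : 0 <= l ->
  `|huber l del (x + t) - huber l del x - t * (l * Num.min x del)|
    <= l / 2 * t ^+ 2.
Proof.
move=> l0; rewrite /huber.
set a := Num.min (x + t) del; set b := Num.min x del.
have -> : l * (a * (x + t) - a ^+ 2 / 2) - l * (b * x - b ^+ 2 / 2)
          - t * (l * b)
        = l * (a * (x + t) - a ^+ 2 / 2 - (b * x - b ^+ 2 / 2) - t * b).
  by ring.
rewrite normrM ger0_norm// -mulrA ler_wpM2l// ler_norml {}/a {}/b.
by case: (leP (x + t) del) => ?; case: (leP x del) => ?; apply/andP; split; nra.
Qed.

Lemma differentiable_huber (R : realType) (l del x : R) : 0 <= l ->
  differentiable (huber l del) x.
Proof.
move=> l0; apply/derivable1_diffP.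
apply: (@ex_derive _ _ _ _ _ _ (l * Num.min x del)).
apply: (@is_derive_quadratic_bound _ _ _ _ _ _ (l / 2)) => t.
by rewrite [t *: 1]mulr1 [t + x]addrC; apply: huber_quadratic_bound.
Qed.

Lemma huber_ge0 (R : realType) (l del x : R) : 0 <= l -> 0 <= del ->
  0 <= huber l del x.
Proof.
move=> l0 del0; apply: mulr_ge0 => //.
by case: (leP x del) => ?; nra.
Qed.

Lemma huber_ge_del (R : realType) (l del x : R) : del <= x ->
  huber l del x = l * (del * x - del ^+ 2 / 2).
Proof. by move=> ?; rewrite /huber min_r. Qed.

Lemma min_lipschitz_sqr (R : realType) (del a b : R) :
  (Num.min a del - Num.min b del) ^+ 2 <= (a - b) ^+ 2.
Proof.
case: (leP a del) => ?; case: (leP b del) => ? //; [nra|nra|].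
by rewrite subrr expr0n sqr_ge0.
Qed.

(** * The squared Euclidean norm *)

Lemma enorm_sqr (R : realType) n (v : 'rV[R]_n) :
  enorm v ^+ 2 = \sum_(i < n) v ord0 i ^+ 2.
Proof. by rewrite sqr_sqrtr// sumr_ge0// => i _; rewrite sqr_ge0. Qed.

Lemma enorm_ge0 (R : realType) n (v : 'rV[R]_n) : 0 <= enorm v.
Proof. exact: sqrtr_ge0. Qed.

Lemma enorm_sqrZ (R : realType) n (a : R) (v : 'rV[R]_n) :
  enorm (a *: v) ^+ 2 = a ^+ 2 * enorm v ^+ 2.
Proof.
by rewrite !enorm_sqr mulr_sumr; apply: eq_bigr => i _; rewrite mxE exprMn.
Qed.

Lemma enorm_sqr_delta (R : realType) n (i : 'I_n) :
  enorm (delta_mx ord0 i : 'rV[R]_n) ^+ 2 = 1.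
Proof.
rewrite enorm_sqr (bigD1 i)//= big1 ?addr0 => [|j /negPf ji];
  by rewrite !mxE ?ji !eqxx ?expr1n ?expr0n.
Qed.

Lemma enorm_sqr_coord (R : realType) n (v : 'rV[R]_n) (i : 'I_n) :
  v ord0 i ^+ 2 <= enorm v ^+ 2.
Proof.
rewrite enorm_sqr (bigD1 i)//= lerDl sumr_ge0// => j _.
by rewrite sqr_ge0.
Qed.

Lemma enorm_sqrD_delta (R : realType) n (v : 'rV[R]_n) (i : 'I_n) (t : R) :
  enorm (t *: delta_mx ord0 i + v) ^+ 2
  = enorm v ^+ 2 + t * (2 * v ord0 i) + t ^+ 2.
Proof.
rewrite !enorm_sqr (bigD1 i)//= [in RHS](bigD1 i)//= !mxE !eqxx /=.
rewrite (eq_bigr (fun j => v ord0 j ^+ 2)) => [|j /negPf ji]; first by ring.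
by rewrite !mxE ji andbF mulr0 add0r.
Qed.

Lemma enorm_sqr_convex (R : realType) n (u v : 'rV[R]_n) (s : R) :
  enorm (s *: u + (1 - s) *: v) ^+ 2
  = s * enorm u ^+ 2 + (1 - s) * enorm v ^+ 2
    - s * (1 - s) * enorm (u - v) ^+ 2.
Proof.
rewrite !enorm_sqr !mulr_sumr -big_split -sumrB /=.
by apply: eq_bigr => i _; rewrite !mxE; ring.
Qed.

Lemma differentiable_enorm_sqr (R : realType) n (v : 'rV[R]_n) :
  differentiable (fun w : 'rV[R]_n => enorm w ^+ 2) v.
Proof.
have -> : (fun w : 'rV[R]_n => enorm w ^+ 2)
    = \sum_(i < n) (fun w : 'rV[R]_n => w ord0 i ^+ 2).
  by apply/funext => w; rewrite enorm_sqr fct_sumE.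
apply: differentiable_sum => i.
have -> : (fun w : 'rV[R]_n => w ord0 i ^+ 2)
    = (fun w : 'rV[R]_n => w ord0 i) ^+ 2 by [].
exact/differentiableX/differentiable_coord.
Qed.

(** * The hard instance and its regularity *)

Definition hard_primal (R : realType) m (l del : R) (x : 'rV[R]_m.+1) : R :=
  huber l del (x ord0 ord0).

Definition hard_fun (R : realType) m n (l mu del : R) (x : 'rV[R]_m.+1)
    (y : 'rV[R]_n) : R :=
  hard_primal l del x - mu / 2 * enorm y ^+ 2.

Lemma grad_hard_primal (R : realType) m (l del C : R) (x : 'rV[R]_m.+1) :
  0 <= l ->
  grad (fun z => hard_primal l del z - C) x
  = (l * Num.min (x ord0 ord0) del) *: delta_mx ord0 ord0.
Proof.
move=> l0; apply/rowP => i; rewrite !mxE eqxx andTb.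
apply: (@derive_val _ _ _ _ _ _ _ _).
apply: (@is_derive_quadratic_bound _ _ _ _ _ _ (l / 2)) => t.
rewrite /hard_primal !mxE eqxx andTb [ord0 == i]eq_sym.
case: (i == ord0) => /=.
  rewrite !mulr1 addrC; apply: le_trans (huber_quadratic_bound del (x ord0 ord0) t l0).
  by rewrite le_eqVlt; apply/orP; left; apply/eqP; congr `|_|; ring.
by rewrite !mulr0 add0r subrr subr0 normr0 mulr_ge0 ?sqr_ge0 ?divr_ge0.
Qed.

Lemma gradx_hard_fun (R : realType) m n (l mu del : R) (x : 'rV[R]_m.+1)
    (y : 'rV[R]_n) : 0 <= l ->
  gradx (hard_fun l mu del) x y
  = (l * Num.min (x ord0 ord0) del) *: delta_mx ord0 ord0.
Proof. exact: grad_hard_primal. Qed.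

Lemma grady_hard_fun (R : realType) m n (l mu del : R) (x : 'rV[R]_m.+1)
    (y : 'rV[R]_n) : 0 <= mu ->
  grady (hard_fun l mu del) x y = - mu *: y.
Proof.
move=> mu0; apply/rowP => i; rewrite !mxE.
apply: (@derive_val _ _ _ _ _ _ _ _).
apply: (@is_derive_quadratic_bound _ _ _ _ _ _ (mu / 2)) => t.
rewrite /hard_fun enorm_sqrD_delta.
set A := (X in `|X|).
have -> : A = - (mu / 2 * t ^+ 2) by rewrite /A; field.
by rewrite normrN ger0_norm// mulr_ge0 ?sqr_ge0 ?divr_ge0.
Qed.

Lemma smooth_hard_fun (R : realType) m n (l mu del : R) :
  0 <= mu -> mu <= l ->
  smooth l (@hard_fun R m n l mu del).
Proof.
move=> mu0 mul; have l0 : 0 <= l := le_trans mu0 mul.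
split=> [[x y]|x1 x2 y1 y2].
  have dx : differentiable
      (fun q : 'rV[R]_m.+1 * 'rV[R]_n => hard_primal l del q.1) (x, y).
    apply: (@differentiable_comp _ _ _ _ fst (hard_primal l del)).
      by apply: linear_differentiable => q; exact: cvg_fst.
    apply: (@differentiable_comp _ _ _ _ (fun z : 'rV[R]_m.+1 => z ord0 ord0)
      (huber l del)); first exact: differentiable_coord.
    exact: differentiable_huber.
  have dy : differentiable
      (fun q : 'rV[R]_m.+1 * 'rV[R]_n => enorm q.2 ^+ 2) (x, y).
    apply: (@differentiable_comp _ _ _ _ snd
      (fun w : 'rV[R]_n => enorm w ^+ 2)).
      by apply: linear_differentiable => q; exact: cvg_snd.
    exact: differentiable_enorm_sqr.
  exact: differentiableB dx (differentiableZ (mu / 2) dy).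
(* The two blocks are compared separately: truncation at [del] is 1-Lipschitz, and the [y]-gradient
   scales by [mu <= l]. *)
rewrite !gradx_hard_fun// !grady_hard_fun// -scalerBl -mulrBr.
rewrite -[X in _ + enorm X ^+ 2]scalerBr !enorm_sqrZ enorm_sqr_delta mulr1 exprMn sqrrN lerD//.
  rewrite ler_wpM2l ?sqr_ge0//; apply: le_trans (enorm_sqr_coord _ ord0).
  by rewrite !mxE; exact: min_lipschitz_sqr.
by rewrite ler_wpM2r ?sqr_ge0// ler_sqr ?nnegrE.
Qed.

Lemma strongly_concave_hard_fun (R : realType) m n (l mu del : R)
    (x : 'rV[R]_m.+1) :
  strongly_concave mu (@hard_fun R m n l mu del x).
Proof.
(* The [x]-term is constant in [y], and the quadratic meets the strong concavity bound with
   equality. *)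
move=> y1 y2 s _; rewrite /hard_fun enorm_sqr_convex le_eqVlt.
by apply/orP; left; apply/eqP; field.
Qed.

Lemma is_primal_hard_fun (R : realType) m n (l mu del : R) : 0 <= mu ->
  is_primal (@hard_fun R m n l mu del) (hard_primal l del).
Proof.
move=> mu0 x.
have e0 : enorm (0 : 'rV[R]_n) ^+ 2 = 0.
  by rewrite enorm_sqr big1// => i _; rewrite mxE expr0n.
exists 0 => [|y]; rewrite /hard_fun e0 mulr0 subr0// gerBl.
by rewrite mulr_ge0 ?sqr_ge0 ?divr_ge0.
Qed.

(** * Speed of GDA and the iteration count *)

(** The slope in [x] never exceeds [l * del], so each step lowers the first coordinate by at most
    [etax * (l * del)]. *)
Lemma gda_hard_fun_ge (R : realType) m n (etax etay l mu del : R)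
    (x0 : 'rV[R]_m.+1) (y0 : 'rV[R]_n) (t : nat) :
  0 <= etax -> 0 <= l ->
  x0 ord0 ord0 - t%:R * (etax * (l * del))
  <= (gda etax etay (hard_fun l mu del) x0 y0 t).1 ord0 ord0.
Proof.
move=> eta0 l0; elim: t => [|t IH]; first by rewrite mul0r subr0.
rewrite /gda iterS -/(gda _ _ _ _ _ _) /= gradx_hard_fun// !mxE !eqxx mulr1.
rewrite -natr1 mulrDl mul1r opprD addrA lerD// lerN2.
by rewrite !ler_wpM2l// ge_min lexx orbT.
Qed.

Theorem theorem4p5 (R : realType) (c1 c2 l : R)
    (hc1 : 0 < c1) (hc2 : 0 < c2) (hl : 0 < l) :
  exists2 c : R, 0 < c &
    forall (m n : nat), (0 < m)%N -> (0 < n)%N ->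
    forall mu Delta : R, 0 < mu -> mu <= l -> 0 < Delta ->
    exists2 eps0 : R, 0 < eps0 &
      forall eps : R, 0 < eps -> eps <= eps0 ->
      let kappa := l / mu in
      let etax := c1 / (kappa ^+ 2 * l) in
      let etay := c2 / l in
      exists (f : 'rV[R]_m -> 'rV[R]_n -> R) (Phi : 'rV[R]_m -> R)
             (x0 : 'rV[R]_m) (y0 : 'rV[R]_n),
        let x := fun t : nat => (gda etax etay f x0 y0 t).1 in
        [/\ smooth l f,
            forall z : 'rV[R]_m, strongly_concave mu (f z),
            is_primal f Phi,
            is_primal_gap Phi x0 (x 1%N) Delta &
            forall T t : nat, (1 <= t <= T)%N ->
              enorm (grad Phi (x t)) <= eps ->
              c * (kappa ^+ 2 * Delta / eps ^+ 2) <= T%:R].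
Proof.
(* This is [Delta / (4 * eps ^+ 2 * etax)] with [etax = c1 / (kappa ^+ 2 * l)] inserted. *)
exists (l / (4 * c1)); first by rewrite divr_gt0// mulr_gt0.
case=> // m n _ _ mu Delta mu0 mul Delta0.
pose kappa := l / mu; pose etax := c1 / (kappa ^+ 2 * l).
have kappa0 : 0 < kappa by rewrite divr_gt0.
have etax0 : 0 < etax by rewrite divr_gt0// mulr_gt0// exprn_gt0.
(* The condition [eps ^+ 2 * b <= Delta] says exactly that the first GDA step does not leave the
   linear zone, as [X1ge] records. *)
pose b := 2 / l + 4 * etax.
have b0 : 0 < b by apply: addr_gt0; [exact: divr_gt0|exact: mulr_gt0].
exists (Num.sqrt (Delta / b)); first by rewrite sqrtr_gt0 divr_gt0.
move=> eps eps0 epsle /=.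
rewrite -/kappa -/etax.
have {b0 epsle} epsb : eps ^+ 2 * b <= Delta.
  rewrite -ler_pdivlMr// -[leRHS]sqr_sqrtr ?(ltW (divr_gt0 Delta0 b0))//.
  by rewrite ler_sqr ?nnegrE ?sqrtr_ge0 ?(ltW eps0).
(* [del] makes the outer slope [2 * eps]; [X0] is the point of the linear piece at height
   [Delta]. *)
pose del := 2 * eps / l; pose X0 := Delta / (2 * eps) + eps / l.
have ldel : l * del = 2 * eps by rewrite /del mulrCA divff ?mulr1// gt_eqF.
have l0 := ltW hl.
have del0 : 0 <= del by rewrite divr_ge0// mulr_ge0// ltW.
have X0E : l * (del * X0 - del ^+ 2 / 2) = Delta.
  by rewrite /X0 /del; field; rewrite !gt_eqF.
have X1ge : del <= X0 - etax * (l * del).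
  rewrite ldel /X0 /del.
  have -> : Delta / (2 * eps) = (Delta / eps) / 2 by field; rewrite gt_eqF.
  have : eps * b <= Delta / eps by rewrite ler_pdivlMr// mulrAC -expr2.
  have -> : eps * b = 2 * (eps / l) + 4 * (eps * etax).
    by rewrite /b; field; rewrite gt_eqF.
  have -> : 2 * eps / l = 2 * (eps / l) by rewrite mulrA.
  lra.
have step0 : 0 <= etax * (l * del).
  by apply: mulr_ge0; [exact: ltW|exact: mulr_ge0].
have X0ge : del <= X0 by apply: le_trans X1ge _; rewrite gerBl.
pose x0 : 'rV[R]_m.+1 := X0 *: delta_mx ord0 ord0.
have x0E : x0 ord0 ord0 = X0 by rewrite !mxE !eqxx mulr1.
exists (hard_fun l mu del), (hard_primal l del), x0, 0.
split.
- by apply: smooth_hard_fun => //; exact: ltW.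
- by move=> z; exact: strongly_concave_hard_fun.
- by apply: is_primal_hard_fun; exact: ltW.
- exists 0 => [x|].
    rewrite {1}/hard_primal /huber mxE min_l// mul0r expr0n mul0r subr0 mulr0.
    exact: huber_ge0.
  (* The minimum value is 0, at the origin. Both [x0] and the first iterate lie in the increasing
     linear zone, so the maximum is the value at [x0]. *)
  have Phi0 : hard_primal l del x0 = Delta.
    by rewrite /hard_primal x0E huber_ge_del.
  rewrite Phi0 {2}/hard_primal /huber mxE min_l// mul0r expr0n mul0r subr0 mulr0.
  rewrite subr0 max_r// -X0E /= gradx_hard_fun//.
  rewrite /hard_primal !mxE !eqxx !mulr1 min_r// huber_ge_del//.
  by rewrite ler_wpM2l// lerD2r ler_wpM2l// gerBl; exact: step0.
- move=> T t /andP[_ tT].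
  have := gda_hard_fun_ge (c2 / l) mu del x0 (0 : 'rV[R]_n) t (ltW etax0) l0.
  set x := (gda _ _ _ _ _ _).1 => lb small.
  have : enorm (grad (hard_primal l del) x) ^+ 2 <= eps ^+ 2.
    by rewrite ler_sqr ?nnegrE ?enorm_ge0 ?(ltW eps0).
  have -> : hard_primal l del = (fun z : 'rV[R]_m.+1 => hard_primal l del z - 0).
    by apply/funext => z; rewrite subr0.
  rewrite grad_hard_primal// enorm_sqrZ enorm_sqr_delta mulr1 => sq.
  (* In the linear zone the gradient norm would be [2 * eps], so the point is in the quadratic zone,
     where the slope is [l] times the coordinate. *)
  have {sq} xle : x ord0 ord0 <= eps / l.
    rewrite ler_pdivlMr// mulrC.
    by move: sq; case: (leP (x ord0 ord0) del) => _ sq; nra.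
  (* The [eps / l] in [X0] cancels the threshold, leaving a distance of exactly [Delta / (2 * eps)]
     to cover. *)
  move: lb; rewrite x0E ldel => /le_trans/(_ xle); rewrite /X0 => lb.
  apply: (@le_trans _ _ t%:R); last by rewrite ler_nat.
  have -> : l / (4 * c1) * (kappa ^+ 2 * Delta / eps ^+ 2)
      = Delta / (2 * eps) / (etax * (2 * eps)).
    by rewrite /etax; field; rewrite ?gt_eqF.
  rewrite ler_pdivrMr; last by apply: mulr_gt0 => //; exact: mulr_gt0.
  lra.
Qed.
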